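(* Let $(\mathcal X,\mathcal B,\pi)$ be a measure space with $\pi$ $\sigma$-finite, $r:\mathcal X\to\mathbb R$ measurable, $\{\varepsilon(x)\}$ a real-valued random field with i.i.d. copies independent of sampled points, $\alpha\in(0,1)$, $p_0,p_{\rm ref}\in\mathcal P_\pi$ with $\int p|\log p|\,d\pi<\infty$ for $p\in\{p_0,p_{\rm ref}\}$, and $K\in\{2,3,\dots\}\cup\{\infty\}$. If $K=\infty$, assume additionally that for every $p\in\mathcal P_\pi$, $\mathbb E_{X\sim p}[e^{|r(X)+\varepsilon(X)|}]<\infty$, and that $0<Q_*<\infty$ with $Q(x)\le Q_*$ for all $x$. Define recursively $p_{t+1}$ as a maximizer over $p\in\mathcal P_\pi$ of $$\mathcal L(p;p_t,K,\alpha)=\alpha\,\mathbb E_{X\sim p_{\rm ref}}[\log p(X)]+(1-\alpha)\,\mathbb E_{X\sim p_t}\bigl[\log p(X)\,H^K_{p_t}(X)\bigr].$$ Then for every $t\in\mathbb N$ this functional has a unique maximizer over $p\in\mathcal P_\pi$, given by $$p_{t+1}(x)=\alpha\,p_{\rm ref}(x)+(1-\alpha)\,p_t(x)\,H^K_{p_t}(x).$$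
   Context: $\mathcal P_\pi$ is the set of probability measures on $(\mathcal X,\mathcal B)$ absolutely continuous w.r.t. $\pi$, identified with their densities. $Q(x):=e^{r(x)}\mathbb E[e^{\varepsilon(x)}]$ and $Q_*:=\operatorname*{ess\,sup}_\pi Q$. For finite $K$, $H^K_p(x):=\mathbb E\bigl[K e^{r(x)+\varepsilon(x)}/(e^{r(x)+\varepsilon(x)}+\sum_{k=1}^{K-1}e^{r(X_k)+\varepsilon_k(X_k)})\bigr]$ with $X_1,\dots,X_{K-1}$ i.i.d. with density $p$ independent of the i.i.d. noise copies $\varepsilon,\varepsilon_1,\dots$; for $K=\infty$, $H^\infty_p(x):=\lim_{K\to\infty}H^K_p(x)$, which under the stated exponential integrability equals $Q(x)/\mathbb E_{X\sim p}Q(X)$. *)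

(* Defs.v *)
From HB Require Import structures.
From mathcomp Require Import all_boot all_order all_algebra.
From mathcomp Require Import all_classical all_reals all_analysis ess_sup_inf.
Set Implicit Arguments. Unset Strict Implicit. Unset Printing Implicit Defensive.
Import Order.TTheory GRing.Theory Num.Def Num.Theory.
Import numFieldNormedType.Exports.
Local Open Scope classical_set_scope.
Local Open Scope ring_scope.
Local Open Scope ereal_scope.

Section defs.
Context {R : realType} {d : measure_display} {X : measurableType d}
  {dO : measure_display} {Om : measurableType dO}.
Variables (pi : {measure set X -> \bar R}) (P : probability Om R).
Variables (r : X -> R) (eps : X -> Om -> R).

Definition is_density (p : X -> R) : Prop :=
  measurable_fun setT p /\ (forall x, (0 <= p x)%R) /\ \int[pi]_x (p x)%:E = 1.

Definition elog (y : R) : \bar R := if (0 < y)%R then (ln y)%:E else -oo.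

(* Iterated integral realizing the expectation over X_1..X_{K-1} i.i.d. ~ p
   and independent noise copies eps_1..eps_{K-1} (product measure, Tonelli).
   a = e^{r(x)+eps(x)}, s = accumulated sum of e^{r(X_k)+eps_k(X_k)}. *)
Fixpoint Hiter (k : nat) (p : X -> R) (n : nat) (a s : R) : \bar R :=
  match n with
  | 0%N => ((k%:R * a) / (a + s))%:E
  | n'.+1 => \int[pi]_y ((p y)%:E *
               \int[P]_w Hiter k p n' a (s + expR (r y + eps y w)))
  end.

Definition HK (k : nat) (p : X -> R) (x : X) : \bar R :=
  \int[P]_w Hiter k p k.-1 (expR (r x + eps x w)) 0.

(* K in {2,3,...} ∪ {∞}: Some k = finite K, None = ∞ *)
Definition H (K : option nat) (p : X -> R) (x : X) : \bar R :=
  match K with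
  | Some k => HK k p x
  | None => limn (fun k => HK k p x)
  end.

Definition Qf (x : X) : \bar R := (expR (r x))%:E * \int[P]_w (expR (eps x w))%:E.

Definition Qstar : \bar R := ess_sup pi Qf.

Definition Lobj (K : option nat) (alpha : R) (pref pt q : X -> R) : \bar R :=
  alpha%:E * \int[pi]_x ((pref x)%:E * elog (q x)) +
  (1 - alpha)%:E * \int[pi]_x ((pt x)%:E * H K pt x * elog (q x)).

Definition is_maximizer (K : option nat) (alpha : R) (pref pt q : X -> R) : Prop :=
  is_density q /\
  forall q', is_density q' -> Lobj K alpha pref pt q' <= Lobj K alpha pref pt q.

End defs.

(* Main.v *)
(* For densities f, g with finite entropy, alpha E_f[log q] +
   (1 - alpha) E_g[log q] is the integral of u log q with
   u = alpha f + (1 - alpha) g, so by Gibbs' inequality it is maximal exactly at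
   q = u.  This is applied to f = p_ref and g = p_t H, which has to be shown to
   be a density with finite entropy.

   Write b = e^(r + eps) under X ~ p_t.  For finite K the normalization of p_t H
   is exchangeability: K E[b_1 / (b_1 + ... + b_K)] = 1.  For K = oo one needs
   n E[1 / (a + S_(n-1))] -> 1/m for S_n a sum of n copies of b and m = E[b].
   Jensen's inequality bounds the limit from below; the upper bound follows from
   the exchangeability identity E[b n / (b + S_(n-1))] = 1, because
   a |-> E[1 / (a + S_(n-1))] is nonincreasing.  Finally E[1/b] < oo dominates
   the sequence, so that H(x) = Q(x)/m pointwise.  As H is bounded, p_t H
   inherits finite entropy from p_t, and so does the mixture p_(t+1). *)
Require Import Defs.
From HB Require Import structures.
From mathcomp Require Import all_boot all_order all_algebra.
From mathcomp Require Import all_classical all_reals all_analysis ess_sup_inf.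
From mathcomp Require Import measurable_realfun ring lra.
Import Order.TTheory GRing.Theory Num.Def Num.Theory.
Import numFieldNormedType.Exports.
Local Open Scope classical_set_scope.
Local Open Scope ring_scope.
Local Open Scope ereal_scope.
Set SsrOldRewriteGoalsOrder.
Set Implicit Arguments. Unset Strict Implicit.

(** * Probability with a given density *)

Section density_probability.
Context {R : realType} {d : measure_display} {X : measurableType d}.
Context {mu : {measure set X -> \bar R}} {p : X -> R}.

(** The proof [pd] is an argument so that the measure and probability structures can be attached to
    the term [density_prob pd]. *)
Definition density_prob (pd : is_density mu p) (A : set X) : \bar R :=
  \int[mu]_(x in A) (p x)%:E.

Context (pd : is_density mu p).

Let mp : measurable_fun setT (fun x => (p x)%:E).
Proof. by apply/measurable_EFinP; case: pd. Qed.

Let p0 x : 0 <= (p x)%:E.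
Proof. by case: (pd) => _ [h _]; rewrite lee_fin. Qed.

Let density_prob0 : density_prob pd set0 = 0.
Proof. by rewrite /density_prob integral_set0. Qed.

Let density_prob_ge0 A : 0 <= density_prob pd A.
Proof. exact: integral_ge0. Qed.

Let density_prob_sigma_additive : semi_sigma_additive (density_prob pd).
Proof. exact: semi_sigma_additive_nng_induced. Qed.

HB.instance Definition _ := isMeasure.Build _ _ _ (density_prob pd)
  density_prob0 density_prob_ge0 density_prob_sigma_additive.

Let density_prob_setT : density_prob pd setT = 1.
Proof. exact: (proj2 (proj2 pd)). Qed.

HB.instance Definition _ :=
  Measure_isProbability.Build _ _ _ (density_prob pd) density_prob_setT.

Import HBNNSimple.

(** By monotone convergence both sides are limits along simple functions increasing to [f];
    linearity then leaves indicators of level sets. *)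
Lemma ge0_integral_density_prob (f : X -> \bar R) : (forall x, 0 <= f x) ->
  measurable_fun setT f ->
  \int[density_prob pd]_x f x = \int[mu]_x ((p x)%:E * f x).
Proof.
move=> f0 mf; pose h := nnsfun_approx measurableT mf.
have -> : \int[density_prob pd]_x f x =
    limn (fun n => \int[density_prob pd]_x (EFin \o h n) x).
  rewrite -monotone_convergence//.
  - apply: eq_integral => x _; apply/esym; apply: cvg_lim => //.
    exact: cvg_nnsfun_approx.
  - by move=> n; apply/measurable_EFinP.
  - by move=> n x _; rewrite lee_fin.
  - by move=> x _ i j ij; rewrite lee_fin; exact/lefP/nd_nnsfun_approx.
have -> : \int[mu]_x ((p x)%:E * f x) =
    limn (fun n => \int[mu]_x ((p x)%:E * (h n x)%:E)).
  rewrite -monotone_convergence//.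
  - apply: eq_integral => x _; apply/esym; apply: cvg_lim => //.
    apply: (@cvgeZl _ _ _ (EFin \o h ^~ x)) => //; exact: cvg_nnsfun_approx.
  - by move=> n; apply: emeasurable_funM => //; apply/measurable_EFinP.
  - by move=> n x _; rewrite mule_ge0// lee_fin.
  - move=> x _ i j ij; apply: lee_wpmul2l => //.
    by rewrite lee_fin; exact/lefP/nd_nnsfun_approx.
suff suf n : \int[density_prob pd]_x (EFin \o h n) x =
    \int[mu]_x ((p x)%:E * (h n x)%:E) by under eq_fun do rewrite suf.
have hE x : (h n x)%:E =
    \sum_(y \in range (h n)) (y * \1_(h n @^-1` [set y]) x)%:E.
  by rewrite [in LHS]fimfunE -fsumEFin.
under [LHS]eq_integral do rewrite /= hE.
rewrite ge0_integral_fsum//; last 2 first.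
  by move=> y; apply/measurable_EFinP; exact: measurable_funM.
  by move=> y x _; exact: nnfun_muleindic_ge0.
under [RHS]eq_integral => x _.
  rewrite hE ge0_mule_fsumr; last by move=> y; exact: nnfun_muleindic_ge0.
  over.
rewrite /=.
rewrite ge0_integral_fsum//.
- apply: eq_fsbigr => y /set_mem [x _ yE].
  have y0 : 0 <= y%:E by rewrite -yE lee_fin.
  have mhy : measurable (h n @^-1` [set y]) by exact: measurable_funPTI.
  rewrite integralZl_indic_nnsfun// integral_indic// setIT.
  under [RHS]eq_integral do rewrite EFinM muleCA.
  rewrite ge0_integralZl//.
  (* For one level set the claim is the definition of [density_prob]. *)
  + congr (_ * _); rewrite -[LHS]/(density_prob pd _) /density_prob integral_mkcond.
    by apply: eq_integral => z _; rewrite epatch_indic.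
  + by apply: emeasurable_funM => //; apply/measurable_EFinP.
  + by move=> z _; rewrite mule_ge0// lee_fin.
- by move=> y; apply: emeasurable_funM => //; apply/measurable_EFinP;
    exact: measurable_funM.
- by move=> y x _; rewrite mule_ge0//; exact: nnfun_muleindic_ge0.
Qed.

End density_probability.

(** * Expected inverse of a partial sum *)

(** The ratio equals 1/m + (c - e/m) / (e + n m), whose second term vanishes at infinity. *)
Lemma cvg_ratio {R : realType} (c e m : R) : (0 < e)%R -> (0 < m)%R ->
  ((n%:R + c) / (e + n%:R * m))%R @[n --> \oo] --> (m^-1)%R.
Proof.
move=> e0 m0.
have den n : (0 < e + n%:R * m)%R by rewrite ltr_wpDr// mulr_ge0// ltW.
have -> : (fun n : nat => (n%:R + c) / (e + n%:R * m))%R =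
    (fun n : nat => m^-1 + (c - e / m) * (e + n%:R * m)^-1)%R.
  by apply/funext => n; field; rewrite !gt_eqF.
rewrite -[X in _ --> X]addr0; apply: cvgD; first exact: cvg_cst.
rewrite -(mulr0 (c - e / m)%R); apply: cvgMl_tmp.
apply/gtr0_cvgV0; first by near=> n; exact: den.
apply/cvgryPge => A; near=> n.
apply: ltW; apply: ltr_wpDl (ltW e0) _; rewrite -ltr_pdivrMr//.
by near: n; exact: nbhs_infty_gtr.
Unshelve. all: by end_near. Qed.

(** For numerals, [k + n] reduces to iterated successors of [n], so this form applies by conversion
    to ratios such as [n.+2%:R / (e + n.+1%:R * m)]. *)
Lemma cvg_ratio_addn {R : realType} (k j : nat) (e m : R) :
  (0 < e)%R -> (0 < m)%R ->
  ((k + n)%:R / (e + (j + n)%:R * m))%R @[n --> \oo] --> (m^-1)%R.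
Proof.
move=> e0 m0.
rewrite (_ : (fun n => _) =
    (fun n => (n%:R + k%:R) / (e + j%:R * m + n%:R * m))%R).
  by apply: cvg_ratio => //; rewrite ltr_wpDr// mulr_ge0// ltW.
by apply/funext => n; rewrite !natrD (mulrDl j%:R)%R addrA [(k%:R + _)%R]addrC.
Qed.

Lemma ereal_cvg_shiftS {R : realType} (u : nat -> \bar R) (l : \bar R) :
  u n.+1 @[n --> \oo] --> l -> u n @[n --> \oo] --> l.
Proof. by move=> h; rewrite -cvg_shiftS. Qed.

Lemma measurable_inv_ge0 {R : realType} {d : measure_display}
  {T : measurableType d} (D : set T) (f : T -> R) : measurable_fun D f ->
  (forall z, (0 <= f z)%R) -> measurable_fun D (fun z => (f z)^-1)%R.
Proof.
move=> mf f0; rewrite (_ : (fun z => _) = (fun z => powR (f z) (-1))%R).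
  exact: (measurableT_comp (measurable_powR (-1)%R)).
by apply/funext => z; rewrite powR_inv1.
Qed.

Lemma integral_cst_probability {R : realType} {d : measure_display}
  {T : measurableType d} (P : probability T R) (c : \bar R) : \int[P]_z c = c.
Proof.
rewrite (integral_cst P measurableT c) -[RHS]mule1; congr (_ * _).
exact: probability_setT.
Qed.

(** * Exchangeability and bounds for the expected inverse *)

Section inverse_partial_sums.
Context {R : realType} {d : measure_display} {T : measurableType d}.
Context (mu : probability T R) (b : T -> R).

(* E[1 / |s + b_1 + ... + b_n|] for n independent copies of b; the absolute
   value only makes the integrand nonnegative for every s. *)
Fixpoint Einv (n : nat) (s : R) : \bar R :=
  if n is n'.+1 then \int[mu]_z Einv n' (s + b z) else (`|s|^-1)%:E.

Context (mb : measurable_fun setT b) (b0 : forall z, (0 < b z)%R).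

Lemma Einv_ge0 n s : 0 <= Einv n s.
Proof.
elim: n s => [|n IH] s /=; first by rewrite lee_fin invr_ge0.
exact: integral_ge0.
Qed.

Lemma measurable_Einv n : measurable_fun setT (Einv n).
Proof.
elim: n => [|n IH] /=.
  by apply/measurable_EFinP; exact: measurable_inv_ge0.
apply: (measurable_fun_fubini_tonelli_F (m2 := mu)
  (fun z : R * T => Einv n (z.1 + b z.2))); last by move=> z; exact: Einv_ge0.
apply: (measurableT_comp IH); apply: measurable_funD => //.
exact: measurableT_comp.
Qed.

Lemma measurable_EinvD n s : measurable_fun setT (fun z => Einv n (s + b z)).
Proof. by apply: (measurableT_comp (measurable_Einv n)); exact: measurable_funD. Qed.

Lemma Einv_antitone n s s' : (0 < s)%R -> (s <= s')%R -> Einv n s' <= Einv n s.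
Proof.
elim: n s s' => [|n IH] s s' s0 ss' /=.
  by rewrite lee_fin lef_pV2 ?posrE ?normr_gt0 ?gt_eqF ?(lt_le_trans s0)//
    !ger0_norm ?(ltW s0)// (le_trans (ltW s0)).
apply: ge0_le_integral => //; do ?[by move=> *; exact: Einv_ge0 |
  exact: measurable_EinvD].
by move=> z _; apply: IH; rewrite ?addr_gt0// lerD2r.
Qed.

(* With S the sum of n + 1 copies of b, the first term is E[S / (s + S)] by
   exchangeability. *)
Lemma Einv_exchange n s : (0 <= s)%R ->
  n.+1%:R%:E * (\int[mu]_z ((b z)%:E * Einv n (s + b z)))
    + s%:E * Einv n.+1 s = 1.
Proof.
have bE z : 0 <= (b z)%:E by rewrite lee_fin ltW.
have mbE : measurable_fun setT (fun z => (b z)%:E) by exact/measurable_EFinP.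
elim: n s => [|n IH] s s0.
  rewrite mul1e -ge0_integralZl//; last exact: (measurable_EinvD 0).
  rewrite -ge0_integralD//.
  - under eq_integral.
      move=> z _.
      have sb : (0 < s + b z)%R by rewrite ltr_wpDl.
      rewrite /= (gtr0_norm sb) -!EFinM -EFinD -mulrDl addrC divff ?gt_eqF//.
      over.
    exact: integral_cst_probability.
  - by move=> z _; rewrite mule_ge0// Einv_ge0.
  - by apply: emeasurable_funM => //; exact: (measurable_EinvD 0).
  - by move=> z _; rewrite mule_ge0// ?lee_fin// Einv_ge0.
  - by apply: measurable_funeM; exact: (measurable_EinvD 0).
pose G (x : T * T) := (b x.2)%:E * Einv n (s + b x.1 + b x.2).
have mG : measurable_fun setT G.
  apply: emeasurable_funM; first exact: (measurableT_comp mbE).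
  apply: (measurableT_comp (measurable_Einv n)); apply: measurable_funD.
    apply: measurable_funD => //.
    exact: (measurableT_comp mb).
  exact: (measurableT_comp mb).
have G0 x : 0 <= G x by rewrite mule_ge0// Einv_ge0.
set A := \int[mu]_z ((b z)%:E * Einv n.+1 (s + b z)).
(* Tonelli swaps the copy in the numerator with another one; this is the only symmetry that
   exchangeability needs. *)
have AE : A = \int[mu]_w \int[mu]_z G (w, z).
  rewrite (fubini_tonelli G)//; apply: eq_integral => z _ /=.
  rewrite -ge0_integralZl//; first by apply: eq_integral => w _; rewrite addrAC.
    exact: measurable_EinvD.
  by move=> w _; exact: Einv_ge0.
have A0 : 0 <= A by apply: integral_ge0 => z _; rewrite mule_ge0// Einv_ge0.
have mGF : measurable_fun setT (fun w => \int[mu]_z G (w, z)).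
  exact: measurable_fun_fubini_tonelli_F.
have GF0 w : 0 <= \int[mu]_z G (w, z) by exact: integral_ge0.
have mE : measurable_fun setT (fun z => Einv n.+1 (s + b z)).
  exact: measurable_EinvD.
have E0 z : 0 <= Einv n.+1 (s + b z) by exact: Einv_ge0.
have mbEinv : measurable_fun setT (fun z => (b z)%:E * Einv n.+1 (s + b z)).
  exact: emeasurable_funM.
have bEinv0 z : 0 <= (b z)%:E * Einv n.+1 (s + b z) by rewrite mule_ge0.
have msE : measurable_fun setT (fun z => s%:E * Einv n.+1 (s + b z)).
  exact: measurable_funeM.
have sE0 z : 0 <= s%:E * Einv n.+1 (s + b z) by rewrite mule_ge0.
(* Of the n + 2 copies of [A], n + 1 are swapped and one is kept. At fixed [w] the integrand is then
   the induction hypothesis at level [s + b w], the kept copy and the [s] term supplying its last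
   summand. *)
rewrite -natr1 EFinD ge0_muleDl// mul1e {1}AE -addeA.
transitivity (\int[mu]_w (n.+1%:R%:E * (\int[mu]_z G (w, z))
   + ((b w)%:E * Einv n.+1 (s + b w) + s%:E * Einv n.+1 (s + b w)))).
  rewrite [RHS]ge0_integralD//; [|by move=> w _; rewrite mule_ge0
    |exact: measurable_funeM |by move=> w _; rewrite adde_ge0
    |exact: emeasurable_funD].
  rewrite [X in _ = X + _]ge0_integralZl// [X in _ = _ + X]ge0_integralD//.
  by rewrite [X in _ = _ + (_ + X)]ge0_integralZl.
rewrite -[RHS](integral_cst_probability mu); apply: eq_integral => w _.
rewrite -ge0_muleDl// ?lee_fin// -EFinD [(b w + s)%R]addrC.
by apply: (IH (s + b w)%R); rewrite addr_ge0// ltW.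
Qed.

(** The case [s = 0] of [Einv_exchange]: K E[b_1 / (b_1 + ... + b_K)] = 1 with K = n + 1. *)
Lemma integral_mul_Einv n :
  \int[mu]_z ((b z)%:E * (n.+1%:R%:E * Einv n (b z))) = 1.
Proof.
have := @Einv_exchange n 0%R (lexx _); rewrite mul0e adde0 => <-.
under eq_integral do rewrite muleCA.
rewrite ge0_integralZl//; first by congr (_ * _);
  apply: eq_integral => z _; rewrite add0r.
  apply: emeasurable_funM; first exact/measurable_EFinP.
  exact: (measurableT_comp (measurable_Einv n)).
by move=> z _; rewrite mule_ge0 ?lee_fin ?(ltW (b0 z))// Einv_ge0.
Qed.

Lemma Einv_le n s : (0 < s)%R -> Einv n s <= (s^-1)%:E.
Proof.
elim: n s => [|n IH] s s0; first by rewrite /= gtr0_norm.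
rewrite -(integral_cst_probability mu (s^-1)%:E).
apply: ge0_le_integral => //.
- by move=> z _; exact: Einv_ge0.
- exact: measurable_EinvD.
- move=> z _; apply: le_trans (IH _ _) _; first by rewrite addr_gt0.
  by rewrite lee_fin lef_pV2 ?posrE ?addr_gt0// lerDl ltW.
Qed.

Lemma Einv_fin_num n s : (0 < s)%R -> Einv n s \is a fin_num.
Proof.
move=> s0; rewrite ge0_fin_numE ?Einv_ge0//.
exact: le_lt_trans (Einv_le n s0) (ltry _).
Qed.

(* Jensen's inequality, by integrating the tangent line of the inverse at the
   mean. *)
Lemma inv_mean_le_integral_inv m c : \int[mu]_z (b z)%:E = m%:E -> (0 < m)%R ->
  (0 <= c)%R -> ((c + m)^-1)%:E <= \int[mu]_z ((c + b z)^-1)%:E.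
Proof.
move=> bm m0 c0.
have cb z : (0 < c + b z)%R by rewrite ltr_wpDl.
have cm : (0 < c + m)%R by rewrite ltr_wpDl.
have mI : measurable_fun setT (fun z => ((c + b z)^-1)%:E).
  have := measurable_EinvD 0 c.
  by apply: eq_measurable_fun => z _ /=; rewrite gtr0_norm.
have mL : measurable_fun setT (fun z => ((c + b z) / (c + m) ^+ 2)%:E).
  apply/measurable_EFinP; apply: measurable_funM => //.
  exact: measurable_funD.
have IL : \int[mu]_z ((c + b z) / (c + m) ^+ 2)%:E = ((c + m)^-1)%:E.
  under eq_integral do rewrite EFinM EFinD.
  rewrite ge0_integralZr//.
  - rewrite ge0_integralD//; [|by move=> z _; rewrite lee_fin ltW
      |exact/measurable_EFinP].
    rewrite integral_cst_probability bm -EFinD -EFinM.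
    by congr EFin; field; rewrite gt_eqF.
  - by apply: emeasurable_funD => //; exact/measurable_EFinP.
  - by move=> z _; rewrite -EFinD lee_fin ltW.
  - by rewrite lee_fin invr_ge0 sqr_ge0.
(* The tangent line inequality is arranged as a sum, so that only nonnegative functions are
   integrated; its defect is a multiple of (b - m)^2. *)
have H : (2 / (c + m))%:E <=
    \int[mu]_z ((c + b z) / (c + m) ^+ 2)%:E + \int[mu]_z ((c + b z)^-1)%:E.
  rewrite -ge0_integralD//; last 2 first.
  - by move=> z _; rewrite lee_fin divr_ge0 ?sqr_ge0// ltW.
  - by move=> z _; rewrite lee_fin invr_ge0 ltW.
  rewrite -(integral_cst_probability mu (2 / (c + m))%:E).
  apply: ge0_le_integral => //.
  - by move=> z _; rewrite lee_fin divr_ge0// ltW.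
  - exact: emeasurable_funD.
  - move=> z _; rewrite -EFinD lee_fin -subr_ge0.
    rewrite (_ : _ - _ = (c + m)^-1 ^+ 2 * (c + b z)^-1 * (b z - m) ^+ 2)%R.
      by rewrite mulr_ge0 ?sqr_ge0// mulr_ge0 ?sqr_ge0// invr_ge0 ltW.
    by field; rewrite !gt_eqF.
rewrite IL in H; have := H.
rewrite -leeBlDl// -EFinB (_ : _ - _ = (c + m)^-1)%R//.
by field; rewrite gt_eqF.
Qed.

(** The copies are replaced by their mean one at a time: Jensen with [c = s + n m] for one copy, the
    induction hypothesis at [s + b z] for the others. *)
Lemma Einv_ge m n s : \int[mu]_z (b z)%:E = m%:E -> (0 < m)%R ->
  (0 < s)%R -> ((s + n%:R * m)^-1)%:E <= Einv n s.
Proof.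
move=> bm m0; elim: n s => [|n IH] s s0.
  by rewrite mul0r addr0 /= gtr0_norm.
have snm : (0 <= s + n%:R * m)%R by rewrite addr_ge0 ?mulr_ge0 ?(ltW s0) ?(ltW m0).
rewrite -natr1 mulrDl mul1r addrA.
apply: (le_trans (inv_mean_le_integral_inv bm m0 snm)) => /=.
apply: ge0_le_integral => //.
- by move=> z _; rewrite lee_fin invr_ge0 addr_ge0// ltW.
- have := measurable_EinvD 0 (s + n%:R * m).
  by apply: eq_measurable_fun => z _ /=; rewrite gtr0_norm// ltr_wpDl.
- exact: measurable_EinvD.
- by move=> z _; rewrite addrAC; apply: IH; rewrite addr_gt0.
Qed.

(* Convexity of the inverse: 1/(s+b) <= l^2/s + (1-l)^2/b. *)
Lemma Einv_succ_le C n s l : \int[mu]_z ((b z)^-1)%:E <= C%:E ->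
  (0 < s)%R ->
  Einv n.+1 s <= (l ^+ 2)%:E * Einv n s + ((1 - l) ^+ 2 * C)%:E.
Proof.
move=> bC; have C0 : (0 <= C)%R.
  rewrite -lee_fin; apply: le_trans bC; apply: integral_ge0 => z _.
  by rewrite lee_fin invr_ge0 ltW.
have mV : measurable_fun setT (fun z => ((b z)^-1)%:E).
  have := measurable_EinvD 0 0.
  by apply: eq_measurable_fun => z _ /=; rewrite add0r gtr0_norm.
have V0 z : 0 <= ((b z)^-1)%:E by rewrite lee_fin invr_ge0 ltW.
elim: n s => [|n IH] s s0.
  apply: (@le_trans _ _ (\int[mu]_z
      ((l ^+ 2 / s)%:E + ((1 - l) ^+ 2)%:E * ((b z)^-1)%:E))).
    apply: ge0_le_integral => //.
    - exact: (measurable_EinvD 0).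
    - by apply: emeasurable_funD => //; exact: measurable_funeM.
    - move=> z _; have sb : (0 < s + b z)%R by rewrite addr_gt0.
      rewrite /= (gtr0_norm sb) -EFinM -EFinD lee_fin -subr_ge0.
      (* The defect is a square over a positive number, so [l] may be any real. *)
      rewrite (_ : _ - _ = (l * b z - (1 - l) * s) ^+ 2
          * (s * b z * (s + b z))^-1)%R.
        by rewrite mulr_ge0 ?sqr_ge0// invr_ge0 !mulr_ge0// ltW.
      by field; rewrite !gt_eqF.
  rewrite ge0_integralD//; last 3 first.
  - by move=> z _; rewrite lee_fin divr_ge0 ?sqr_ge0// ltW.
  - by move=> z _; rewrite mule_ge0// lee_fin sqr_ge0.
  - exact: measurable_funeM.
  rewrite integral_cst_probability /= gtr0_norm// EFinM leeD2l//.
  rewrite ge0_integralZl// ?lee_fin ?sqr_ge0// (EFinM _ C) lee_wpmul2l//.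
  by rewrite lee_fin sqr_ge0.
apply: (@le_trans _ _ (\int[mu]_z
    ((l ^+ 2)%:E * Einv n (s + b z) + ((1 - l) ^+ 2 * C)%:E))).
  apply: ge0_le_integral => //.
  - by move=> z _; exact: (Einv_ge0 n.+1).
  - exact: (measurable_EinvD n.+1).
  - apply: emeasurable_funD => //; apply: measurable_funeM.
    exact: measurable_EinvD.
  - by move=> z _; apply: IH; rewrite addr_gt0.
rewrite ge0_integralD//; last 3 first.
- by move=> z _; rewrite mule_ge0 ?lee_fin ?sqr_ge0// Einv_ge0.
- by apply: measurable_funeM; exact: measurable_EinvD.
- by move=> z _; rewrite lee_fin mulr_ge0 ?sqr_ge0.
rewrite integral_cst_probability ge0_integralZl//.
- exact: measurable_EinvD.
- by move=> z _; exact: Einv_ge0.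
- by rewrite lee_fin sqr_ge0.
Qed.

(** An averaged form of 1 / (b_1 + ... + b_N) <= (1/b_1 + ... + 1/b_N) / N^2. The bound is uniform
    in [s], which makes it usable for domination. *)
Lemma Einv_le_mean C n s : \int[mu]_z ((b z)^-1)%:E <= C%:E -> (0 < s)%R ->
  Einv n.+1 s <= (C / n.+1%:R)%:E.
Proof.
move=> bC s0; elim: n => [|n IH].
  (* The choice [l = 0] removes the term in [s]. *)
  have := @Einv_succ_le C 0 s 0%R bC s0.
  by rewrite expr0n/= mul0e add0e subr0 expr1n mul1r divr1.
(* This [l] minimizes l^2 C / (n + 1) + (1 - l)^2 C, with minimum C / (n + 2). *)
apply: (le_trans (Einv_succ_le n.+1 (n.+1%:R / n.+2%:R) bC s0)).
apply: (@le_trans _ _ (((n.+1%:R / n.+2%:R) ^+ 2)%:E * (C / n.+1%:R)%:E +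
    ((1 - n.+1%:R / n.+2%:R) ^+ 2 * C)%:E)).
  by rewrite leeD2r// lee_wpmul2l// lee_fin sqr_ge0.
rewrite -EFinM -EFinD lee_fin le_eqVlt; apply/orP; left; apply/eqP.
have -> : (n.+2%:R = n.+1%:R + 1 :> R)%R by rewrite natr1.
have : (0 < n.+1%:R :> R)%R by [].
move: (n.+1%:R : R)%R => x x0.
by field; rewrite !gt_eqF// addr_gt0.
Qed.

End inverse_partial_sums.

(** * Limit of the rescaled expected inverse *)

Section inverse_partial_sums_limit.
Context {R : realType} {d : measure_display} {T : measurableType d}.
Context (mu : probability T R) (b : T -> R) (m : R).
Context (mb : measurable_fun setT b) (b0 : forall z, (0 < b z)%R).
Context (m0 : (0 < m)%R) (bm : \int[mu]_z (b z)%:E = m%:E).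

Local Notation J := (Einv mu b).

Let mbE D : measurable_fun D (fun z => (b z)%:E).
Proof. by apply: measurable_funTS; exact/measurable_EFinP. Qed.

Let bE0 z : 0 <= (b z)%:E.
Proof. by rewrite lee_fin ltW. Qed.

Let low a := [set z | (b z <= a)%R].

Let mlow a : measurable (low a).
Proof.
rewrite (_ : low a = [set z | (b z)%:E <= a%:E]).
  by rewrite -[X in measurable X]setTI; exact: emeasurable_fun_infty_c.
by apply/seteqP; split => z; rewrite /low /= lee_fin.
Qed.

Let low_split (f : T -> \bar R) a : measurable_fun setT f ->
  (forall z, 0 <= f z) ->
  \int[mu]_z f z = \int[mu]_(z in low a) f z + \int[mu]_(z in ~` low a) f z.
Proof.
move=> mf f0; rewrite -ge0_integral_setU ?setUv//.
- exact: measurableC.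
- exact/disj_setPCl.
Qed.

Let low_null a : \int[mu]_(z in low a) (b z)%:E = 0 -> mu (low a) = 0.
Proof.
move=> h.
have /ae_eq_integral_abs : \int[mu]_(z in low a) `|(b z)%:E| = 0.
  by rewrite -[RHS]h; apply: eq_integral => z _; rewrite gee0_abs.
case=> // N [mN N0 lowN]; apply: (subset_measure0 (mlow a) mN) => // z az.
apply: lowN => /(_ az) /eqP; rewrite /cst eqe gt_eqF//.
Qed.

Let mratio n D :
  measurable_fun D (fun z => (b z * (n.+2%:R / (b z + n.+1%:R * m)))%:E).
Proof.
apply: measurable_funTS; apply/measurable_EFinP; apply: measurable_funM => //.
apply: measurable_funM => //; apply: measurable_inv_ge0.
  exact: measurable_funD.
by move=> z; rewrite addr_ge0 ?(ltW (b0 z))// mulr_ge0// ltW.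
Qed.

(* Splits the identity [integral_mul_Einv] at the level a: below it Einv is at
   least its value at a, above it Jensen's lower bound applies. *)
Let low_upper a del n : (0 < a)%R -> \int[mu]_(z in low a) (b z)%:E = del%:E ->
  n.+2%:R%:E * J n.+1 a * del%:E +
    \int[mu]_(z in ~` low a) (b z * (n.+2%:R / (b z + n.+1%:R * m)))%:E <= 1.
Proof.
move=> a0 hdel.
have mbJ D : measurable_fun D (fun z => (b z)%:E * (n.+2%:R%:E * J n.+1 (b z))).
  apply: measurable_funTS; apply: emeasurable_funM => //.
  apply: measurable_funeM; apply: (measurableT_comp _ mb).
  exact: measurable_Einv.
have J0 s : 0 <= n.+2%:R%:E * J n.+1 s by rewrite mule_ge0// Einv_ge0.
have bJ0 z : 0 <= (b z)%:E * (n.+2%:R%:E * J n.+1 (b z)) by rewrite mule_ge0.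
rewrite -(integral_mul_Einv mu mb b0 n.+1) (low_split a)//; apply: leeD.
  rewrite -hdel -ge0_integralZl//; apply: ge0_le_integral => //.
  - by move=> z _; rewrite mule_ge0.
  - exact: measurable_funeM.
  - move=> z az; rewrite muleC lee_wpmul2l// lee_wpmul2l//.
    exact: Einv_antitone.
apply: ge0_le_integral => //.
- exact: measurableC.
- move=> z _; rewrite lee_fin mulr_ge0 ?(ltW (b0 z))// divr_ge0// addr_ge0//.
    exact: ltW.
  by rewrite mulr_ge0// ltW.
- by move=> z _; rewrite EFinM lee_wpmul2l// EFinM lee_wpmul2l//; exact: Einv_ge.
Qed.

(** Dominated convergence: the ratio tends to 1/m and never exceeds 2/m, and [b] is integrable. *)
Let cvg_high a : \int[mu]_(z in ~` low a)
    (b z * (n.+2%:R / (b z + n.+1%:R * m)))%:E @[n --> \oo] -->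
  \int[mu]_(z in ~` low a) (b z * m^-1)%:E.
Proof.
have mbc c : measurable_fun (~` low a) (fun z => (b z * c)%:E).
  apply: measurable_funTS; apply/measurable_EFinP.
  exact: measurable_funM.
have [||||//|] := @dominated_convergence _ _ _ mu (~` low a)
  (measurableC (mlow a))
  (fun n z => (b z * (n.+2%:R / (b z + n.+1%:R * m)))%:E)
  (fun z => (b z * m^-1)%:E) (fun z => (b z * (2 / m))%:E).
- by move=> n; exact: mratio.
- exact: mbc.
- apply: aeW => z _; apply: cvg_EFin; first exact: nearW.
  by apply: cvgMl_tmp; exact: (@cvg_ratio_addn _ 2 1).
- apply: (@integrableS _ _ _ _ setT) => //; first exact: measurableC.
  apply/integrableP; split; first exact/measurable_EFinP/measurable_funM.
  have m20 : 0 <= (2 / m)%:E by rewrite lee_fin divr_ge0// ltW.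
  rewrite (eq_integral (fun z => (b z)%:E * (2 / m)%:E)).
    by rewrite ge0_integralZr// bm -EFinM ltry.
  by move=> z _; rewrite EFinM gee0_abs// mule_ge0.
- apply: aeW => z n _ /=.
  have den : (0 < b z + n.+1%:R * m)%R by rewrite ltr_wpDr ?mulr_ge0// ltW.
  rewrite ger0_norm; last by rewrite mulr_ge0 ?divr_ge0// ltW.
  rewrite lee_fin ler_wpM2l ?(ltW (b0 z))// ler_pdivrMr// mulrAC ler_pdivlMr//.
  have := b0 z; rewrite -[n.+2]addn2 -[n.+1]addn1 !natrD.
  have : (0 <= n%:R :> R)%R by []. nra.
by [].
Qed.

Let low_fin a : exists del, \int[mu]_(z in low a) (b z)%:E = del%:E.
Proof.
exists (fine (\int[mu]_(z in low a) (b z)%:E)); rewrite fineK//.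
rewrite ge0_fin_numE; last exact: integral_ge0.
apply: (@le_lt_trans _ _ m%:E); last exact: ltry.
by rewrite -bm; apply: ge0_subset_integral.
Qed.

(** A squeeze. Jensen bounds from below; from above, [low_upper] is divided by the positive mass
    [del] of [b] on [low a], and (1 - D n) / del tends to (1 - (m - del) / m) / del = 1/m. *)
Let cvg_Einv_low a : (0 < a)%R -> 0 < \int[mu]_(z in low a) (b z)%:E ->
  n.+1%:R%:E * J n a @[n --> \oo] --> (m^-1)%:E.
Proof.
move=> a0; have [del hdel] := low_fin a; rewrite hdel lte_fin => del0.
apply: ereal_cvg_shiftS.
pose D n := \int[mu]_(z in ~` low a)
  (b z * (n.+2%:R / (b z + n.+1%:R * m)))%:E.
have D0 n : 0 <= D n.
  apply: integral_ge0 => z _; rewrite lee_fin mulr_ge0 ?(ltW (b0 z))//.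
  by rewrite divr_ge0// addr_ge0 ?mulr_ge0// ltW.
have up n : n.+2%:R%:E * J n.+1 a * del%:E + D n <= 1 by exact: low_upper.
have Jfin n : n.+2%:R%:E * J n.+1 a \is a fin_num.
  by rewrite fin_numM// Einv_fin_num.
have Dfin n : D n \is a fin_num.
  rewrite ge0_fin_numE//; apply: le_lt_trans (ltry 1).
  apply: le_trans (up n); rewrite leeDr// mule_ge0 ?lee_fin ?(ltW del0)//.
  by rewrite mule_ge0// Einv_ge0.
have cD : D n @[n --> \oo] --> ((m - del) / m)%:E.
  rewrite (_ : ((m - del) / m)%:E = \int[mu]_(z in ~` low a) (b z * m^-1)%:E).
    exact: cvg_high.
  under eq_integral do rewrite EFinM.
  rewrite ge0_integralZr//; [|exact: measurableC|by rewrite lee_fin invr_ge0 ltW].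
  rewrite EFinM EFinB -bm (low_split a)// hdel.
  by rewrite addeAC subee// add0e.
apply: (@squeeze_cvge _ _ _ _ (fun n => (n.+2%:R / (a + n.+1%:R * m))%:E) _
  (fun n => (1 - D n) * (del^-1)%:E)).
- apply: nearW => n; apply/andP; split.
    by rewrite EFinM lee_wpmul2l// Einv_ge.
  by rewrite lee_pdivlMr// leeBrDr.
- apply: cvg_EFin; first exact: nearW.
  exact: (@cvg_ratio_addn _ 2 1).
- rewrite (_ : (m^-1)%:E = (1 - ((m - del) / m)%:E) * (del^-1)%:E).
    apply: cvgeZr => //; apply: cvgeB => //; exact: cvg_cst.
  by rewrite -EFinB -EFinM; congr EFin; field; rewrite !gt_eqF.
Qed.

(** Otherwise all these sublevel sets would be null, although they cover the whole probability
    space. *)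
Let low_ex (a : R) : (0 < a)%R ->
  exists i, 0 < \int[mu]_(z in low (i.+1%:R * a)%R) (b z)%:E.
Proof.
move=> a0; apply: contrapT => /forallNP h.
have low0 i : mu.-negligible (low (i.+1%:R * a)%R).
  apply/negligibleP; first exact: mlow.
  apply: low_null; apply/eqP; rewrite eq_le integral_ge0// andbT leNgt.
  exact/negP/h.
have /negligibleP : mu.-negligible [set: T].
  have -> : [set: T] = \bigcup_i low (i.+1%:R * a)%R.
    apply/seteqP; split => // z _; exists (Num.truncn (b z / a)) => //.
    by rewrite /low /= -ler_pdivrMr// ltW// truncnS_gt.
  exact: negligible_bigcup.
move=> /(_ measurableT); rewrite [LHS]probability_setT => /eqP.
by rewrite eqe oner_eq0.
Qed.

Lemma cvg_Einv a : (0 < a)%R ->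
  n.+1%:R%:E * J n a @[n --> \oo] --> (m^-1)%:E.
Proof.
(* If b gives no mass to ]0, a], one copy of b is traded for the largest
   multiple i * a that b almost surely exceeds: the level (i + 1) * a then
   carries mass, and Einv (n+1) a <= Einv n ((i + 1) * a). *)
move=> a0; have [i ilow imin] := ex_minnP (low_ex a0).
(* Minimality of [i] gives this for positive [i]; for [i = 0] the set is empty because [b] is
   positive. *)
have low0 : mu (low (i%:R * a)%R) = 0.
  case: i ilow imin => [|i] _ imin.
    rewrite mul0r (_ : low 0%R = set0)//; apply/seteqP; split => // z.
    by rewrite /low /= leNgt b0.
  apply: low_null; apply/eqP; rewrite eq_le integral_ge0// andbT leNgt.
  by apply/negP => /imin; rewrite ltnn.
have a'0 : (0 < i.+1%:R * a)%R by rewrite mulr_gt0.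
have JJ n : J n.+1 a <= J n (i.+1%:R * a)%R.
  rewrite -(integral_cst_probability mu (J n (i.+1%:R * a)%R)).
  apply: ae_ge0_le_integral => //.
  - by move=> z _; exact: Einv_ge0.
  - exact: measurable_EinvD.
  - by move=> z _; exact: Einv_ge0.
  exists (low (i%:R * a)%R); split => // z /= /not_implyP[_ Jz].
  apply: contrapT => lz; apply: Jz; apply: Einv_antitone => //.
  rewrite -natr1 mulrDl mul1r addrC lerD2l ltW// ltNge.
  exact/negP.
apply: ereal_cvg_shiftS; apply: ereal_cvg_shiftS.
have cJ : n.+2%:R%:E * J n.+1 (i.+1%:R * a)%R @[n --> \oo] --> (m^-1)%:E.
  by have := cvg_Einv_low a'0 ilow; rewrite -cvg_shiftS.
(* The factor (n + 3) / (n + 2) accounts for the traded copy; its denominator is spelled to match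
   [cvg_ratio_addn] with [e = m = 1]. *)
apply: (@squeeze_cvge _ _ _ _ (fun n => (n.+3%:R / (a + n.+2%:R * m))%:E) _
  (fun n => (n.+3%:R / (1 + n.+1%:R * 1))%:E *
            (n.+2%:R%:E * J n.+1 (i.+1%:R * a)%R))).
- apply: nearW => n; apply/andP; split.
    by rewrite EFinM lee_wpmul2l// Einv_ge.
  by rewrite muleA -EFinM mulr1 nat1r divfK// lee_wpmul2l.
- apply: cvg_EFin; first exact: nearW.
  exact: (@cvg_ratio_addn _ 3 2).
- rewrite -[X in _ --> X]mul1e; apply: cvgeM => //.
  have := @cvg_ratio_addn R 3 1 1 1 ltr01 ltr01; rewrite invr1.
  by move=> h; apply: cvg_EFin => //; exact: nearW.
Qed.

End inverse_partial_sums_limit.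

(** * The selection weight H *)

Section selection_weight.
Context {R : realType} {d : measure_display} {X : measurableType d}.
Context {dO : measure_display} {Om : measurableType dO}.
Context (mu : {measure set X -> \bar R}) (P : probability Om R).
Context (r : X -> R) (eps : X -> Om -> R) (p : X -> R).
Context (r_meas : measurable_fun setT r).
Context (eps_meas : measurable_fun setT (fun z : X * Om => eps z.1 z.2)).
Context (pd : is_density mu p).

Let law : probability (X * Om)%type R := (density_prob pd \x P)%E.

Let b (z : X * Om) : R := expR (r z.1 + eps z.1 z.2).

Let mb : measurable_fun setT b.
Proof.
apply: measurableT_comp => //; apply: measurable_funD => //.
exact: (measurableT_comp r_meas).
Qed.

Let b0 z : (0 < b z)%R.
Proof. exact: expR_gt0. Qed.

Let p0 x : 0 <= (p x)%:E.
Proof. by case: pd => _ [h _]; rewrite lee_fin. Qed.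

Let mp : measurable_fun setT (fun x => (p x)%:E).
Proof. by case: pd => h _; exact/measurable_EFinP. Qed.

(** Tonelli, then the density of the first factor. The right side is the shape of one layer of
    [Hiter], which links it to integrals of [Einv]. *)
Lemma integral_law (f : X * Om -> \bar R) : measurable_fun setT f ->
  (forall z, 0 <= f z) ->
  \int[law]_z f z = \int[mu]_y ((p y)%:E * \int[P]_w f (y, w)).
Proof.
move=> mf f0.
rewrite [LHS](fubini_tonelli1 f)// ge0_integral_density_prob//.
- by move=> x; exact: integral_ge0.
- exact: measurable_fun_fubini_tonelli_F.
Qed.

(** The numerator does not depend on the sampled copies, so it leaves every integral. *)
Lemma HiterE k n a s : (0 < a)%R -> (0 <= s)%R ->
  Hiter mu P r eps k p n a s = (k%:R * a)%:E * Einv law b n (a + s).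
Proof.
move=> a0; elim: n s => [|n IH] s s0.
  by rewrite /= gtr0_norm ?ltr_wpDr// -EFinM.
have mE : measurable_fun setT (fun z => Einv law b n (a + s + b z)).
  exact: measurable_EinvD.
have ka0 : 0 <= (k%:R * a)%:E by rewrite lee_fin mulr_ge0// ltW.
rewrite [RHS]/= -ge0_integralZl//; last by move=> z _; exact: Einv_ge0.
rewrite integral_law; last 2 first.
- exact: measurable_funeM.
- by move=> z; rewrite mule_ge0// Einv_ge0.
apply: eq_integral => y _; congr (_ * _); apply: eq_integral => w _.
by rewrite -addrA; apply: IH; rewrite addr_ge0 ?expR_ge0.
Qed.

(** The mean of K b / (b + S_(K-1)) over the sampled copies, for K = n + 1, at a fixed value of
    [b]. *)
Let weight n z := (b z)%:E * (n.+1%:R%:E * Einv law b n (b z)).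

Let mweight n : measurable_fun setT (weight n).
Proof.
apply: emeasurable_funM; first exact/measurable_EFinP.
apply: measurable_funeM; apply: (measurableT_comp _ mb).
exact: measurable_Einv.
Qed.

Let weight0 n z : 0 <= weight n z.
Proof. by rewrite !mule_ge0 ?lee_fin ?(ltW (b0 z))// Einv_ge0. Qed.

Lemma HKE n x : HK mu P r eps n.+1 p x = \int[P]_w weight n (x, w).
Proof.
rewrite /HK; apply: eq_integral => w _.
rewrite HiterE ?expR_gt0// addr0 /weight muleA -EFinM [in RHS]mulrC.
by [].
Qed.

Lemma HK_le n x : HK mu P r eps n.+1 p x <= n.+1%:R%:E.
Proof.
rewrite HKE -(integral_cst_probability P n.+1%:R%:E).
have b0x w := b0 (x, w).
apply: ge0_le_integral => //.
- exact: (measurableT_comp (mweight n)).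
- move=> w _; apply: (@le_trans _ _
    ((b (x, w))%:E * (n.+1%:R%:E * ((b (x, w))^-1)%:E))).
    by rewrite /weight !lee_wpmul2l// ?lee_fin ?(ltW (b0x w))// Einv_le.
  by rewrite -!EFinM lee_fin mulrCA divff ?gt_eqF// mulr1.
Qed.

Lemma measurable_HK n : measurable_fun setT (HK mu P r eps n.+1 p).
Proof.
rewrite (_ : HK _ _ _ _ _ _ = fun x => \int[P]_w weight n (x, w)).
  exact: measurable_fun_fubini_tonelli_F.
by apply/funext => x; exact: HKE.
Qed.

Lemma HK_ge0 n x : 0 <= HK mu P r eps n.+1 p x.
Proof. by rewrite HKE integral_ge0. Qed.

Lemma integral_density_HK n :
  \int[mu]_x ((p x)%:E * HK mu P r eps n.+1 p x) = 1.
Proof.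
under eq_integral do rewrite HKE.
by rewrite -integral_law// integral_mul_Einv.
Qed.

Let Qx x : \int[P]_w (b (x, w))%:E = Qf P r eps x.
Proof.
rewrite /Qf -ge0_integralZl//.
- by apply: eq_integral => w _; rewrite /b expRD EFinM.
- apply/measurable_EFinP; apply: measurableT_comp => //.
  exact: (measurableT_comp eps_meas (pair1_measurable x)).
Qed.

(** Dominated convergence in the noise at fixed [x]: [cvg_Einv] at level [b (x, w)] gives the
    pointwise limit, and [Einv_le_mean] the dominating function 2 C b. *)
Lemma HK_cvg m C x : (0 < m)%R -> \int[law]_z (b z)%:E = m%:E ->
  \int[law]_z ((b z)^-1)%:E <= C%:E -> Qf P r eps x < +oo ->
  HK mu P r eps n p x @[n --> \oo] --> Qf P r eps x * (m^-1)%:E.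
Proof.
move=> m0 bm bC Qoo.
(* With K = n + 2 there are n + 1 sampled copies, at least one, as [Einv_le_mean] requires. *)
apply: ereal_cvg_shiftS; apply: ereal_cvg_shiftS.
rewrite (_ : (fun n => _) = (fun n => \int[P]_w weight n.+1 (x, w))); last first.
  by apply/funext => n; exact: HKE.
have mbx : measurable_fun setT (fun w => (b (x, w))%:E).
  by apply/measurable_EFinP; exact: (measurableT_comp mb).
have bx0 w : 0 <= (b (x, w))%:E by rewrite lee_fin expR_ge0.
have C0 : (0 <= C)%R.
  rewrite -lee_fin; apply: le_trans bC; apply: integral_ge0 => z _.
  by rewrite lee_fin invr_ge0 ltW.
rewrite -Qx -ge0_integralZr//; last by rewrite lee_fin invr_ge0 ltW.
have [||||//|] := @dominated_convergence _ _ _ P setT measurableT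
  (fun n w => weight n.+1 (x, w)) (fun w => (b (x, w))%:E * (m^-1)%:E)
  (fun w => (b (x, w))%:E * (2 * C)%:E).
- by move=> n; exact: (measurableT_comp (mweight n.+1)).
- exact: emeasurable_funM.
- apply: aeW => w _; apply: cvgeZl => //.
  have := cvg_Einv mb b0 m0 bm (b0 (x, w)).
  by rewrite -cvg_shiftS.
- apply/integrableP; split; first exact: emeasurable_funM.
  rewrite (eq_integral (fun w => (b (x, w))%:E * (2 * C)%:E)); last first.
    by move=> w _; rewrite gee0_abs// mule_ge0// lee_fin mulr_ge0.
  rewrite ge0_integralZr// ?lee_fin ?mulr_ge0// Qx.
  have Q0 : 0 <= Qf P r eps x by rewrite -Qx integral_ge0.
  by rewrite lte_mul_pinfty ?ge0_fin_numE ?ltry.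
- apply: aeW => w n _; rewrite gee0_abs// lee_wpmul2l//.
  apply: (@le_trans _ _ (n.+2%:R%:E * (C / n.+1%:R)%:E)).
    by rewrite lee_wpmul2l// Einv_le_mean.
  rewrite -EFinM lee_fin mulrCA mulrC ler_wpM2r// ler_pdivrMr// -natrM ler_nat.
  by rewrite mul2n -addnn addSn ltnS leq_addl.
by [].
Qed.

(** The function e^|r + eps| dominates both [b] and its inverse. The mean is nonzero since a
    positive function with null integral would make the law zero. *)
Lemma integral_law_moments :
  \int[mu]_y ((p y)%:E * \int[P]_w (expR `|r y + eps y w|)%:E) < +oo ->
  exists m C : R, [/\ (0 < m)%R, \int[law]_z (b z)%:E = m%:E &
    \int[law]_z ((b z)^-1)%:E <= C%:E].
Proof.
pose a (z : X * Om) : R := (expR `|r z.1 + eps z.1 z.2|)%R.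
have ma : measurable_fun setT (fun z => (a z)%:E).
  apply/measurable_EFinP; apply: measurableT_comp => //.
  apply: measurableT_comp => //; apply: measurable_funD => //.
  exact: (measurableT_comp r_meas).
rewrite -(integral_law ma) => [aoo|z]; last by rewrite lee_fin expR_ge0.
have mbE : measurable_fun setT (fun z => (b z)%:E) by exact/measurable_EFinP.
have bE0 z : 0 <= (b z)%:E by rewrite lee_fin ltW.
have bfin : \int[law]_z (b z)%:E \is a fin_num.
  rewrite ge0_fin_numE ?integral_ge0//; apply: le_lt_trans aoo.
  apply: ge0_le_integral => // z _.
  by rewrite lee_fin ler_expR ler_norm.
have afin : \int[law]_z (a z)%:E \is a fin_num.
  by rewrite ge0_fin_numE// integral_ge0// => z _; rewrite lee_fin expR_ge0.
exists (fine (\int[law]_z (b z)%:E)), (fine (\int[law]_z (a z)%:E)).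
rewrite !fineK//; split => //; last first.
  apply: ge0_le_integral => //.
  - by move=> z _; rewrite lee_fin invr_ge0 ltW.
  - by apply/measurable_EFinP; apply: measurable_inv_ge0 => // z; exact: ltW.
  - by move=> z _; rewrite lee_fin /b -expRN ler_expR -normrN ler_norm.
rewrite -lte_fin fineK// lt_neqAle integral_ge0// andbT; apply/eqP => b_eq0.
have /ae_eq_integral_abs : \int[law]_z `|(b z)%:E| = 0.
  by rewrite [RHS]b_eq0; apply: eq_integral => z _; rewrite gee0_abs.
case=> // N [mN N0 subN].
have : law setT = 0.
  apply: (subset_measure0 measurableT mN) => // z _.
  apply: subN => /(_ I) /eqP; by rewrite /cst eqe gt_eqF.
by rewrite probability_setT => /eqP; rewrite eqe oner_eq0.
Qed.

(** Treats finite and infinite K alike from here on. The bound [M] is K itself for finite K, and c/m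
    for K = oo, where [H] is Q/m. *)
Lemma H_bounded K : (forall k, K = Some k -> (2 <= k)%N) ->
  (K = None ->
    \int[mu]_y ((p y)%:E * \int[P]_w (expR `|r y + eps y w|)%:E) < +oo) ->
  (K = None -> exists2 c, c < +oo & forall x, Qf P r eps x <= c) ->
  exists (g : X -> R) (M : R), [/\ measurable_fun setT g,
    forall x, (0 <= g x <= M)%R,
    forall x, H mu P r eps K p x = (g x)%:E &
    \int[mu]_x (p x * g x)%:E = 1].
Proof.
case: K => [[|k]|] K2 Kint KQ; first by have := K2 _ erefl.
  have fin x : HK mu P r eps k.+1 p x \is a fin_num.
    rewrite ge0_fin_numE ?HK_ge0//.
    by apply: le_lt_trans (HK_le _ _) _; rewrite ltry.
  exists (fun x => fine (HK mu P r eps k.+1 p x)), k.+1%:R; split.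
  - by apply: measurableT_comp => //; exact: measurable_HK.
  - move=> x; rewrite fine_ge0 ?HK_ge0//= -lee_fin fineK//; exact: HK_le.
  - by move=> x; rewrite fineK.
  - rewrite -(integral_density_HK k); apply: eq_integral => x _.
    by rewrite EFinM fineK.
have [m [C [m0 bm bC]]] := integral_law_moments (Kint erefl).
have [c coo Qc] := KQ erefl.
have mbE : measurable_fun setT (fun z => (b z)%:E) by exact/measurable_EFinP.
have bE0 z : 0 <= (b z)%:E by rewrite lee_fin ltW.
have Q0 x : 0 <= Qf P r eps x by rewrite -Qx integral_ge0.
have Qfin x : Qf P r eps x \is a fin_num.
  by rewrite ge0_fin_numE//; exact: le_lt_trans (Qc x) coo.
have mQ : measurable_fun setT (Qf P r eps).
  rewrite (_ : Qf _ _ _ = fun x => \int[P]_w (b (x, w))%:E).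
    exact: (measurable_fun_fubini_tonelli_F (fun z => (b z)%:E)).
  by apply/funext => x; rewrite Qx.
exists (fun x => fine (Qf P r eps x) / m)%R, (fine c / m)%R; split.
- by apply: measurable_funM => //; exact: measurableT_comp.
- move=> x; rewrite divr_ge0 ?fine_ge0 ?(ltW m0)//= ler_pM2r ?invr_gt0//.
  rewrite fine_le// ge0_fin_numE//.
  exact: le_trans (Q0 x) (Qc x).
- move=> x; rewrite EFinM fineK//; apply: cvg_lim => //.
  by apply: HK_cvg bC _ => //; exact: le_lt_trans (Qc x) coo.
- transitivity ((m^-1)%:E * \int[mu]_x ((p x)%:E * Qf P r eps x)).
    rewrite -ge0_integralZl//; last 3 first.
    + exact: emeasurable_funM.
    + by move=> x _; rewrite mule_ge0.
    + by rewrite lee_fin invr_ge0 ltW.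
    apply: eq_integral => x _; rewrite !EFinM fineK// [RHS]muleCA.
    by congr (_ * _); exact: muleC.
  under eq_integral do rewrite -Qx.
  rewrite -(integral_law mbE)// bm -EFinM mulVf// gt_eqF//.
Qed.

End selection_weight.

(** * Entropy *)

Section entropy_inequalities.
Context {R : realType}.
Implicit Types u v q a c h M : R.
Local Open Scope ring_scope.

(** This is 1 + x <= e^x at x = ln (q / u), multiplied by [u]; strictness away from x = 0 gives the
    equality case. *)
Lemma mul_ln_le u q : 0 < u -> 0 < q ->
  u * ln q <= u * ln u + q - u ?= iff (q == u).
Proof.
move=> u0 q0; have E : expR (ln q - ln u) = q / u.
  by rewrite -ln_div ?posrE// lnK// posrE divr_gt0.
apply/leifP; case: eqVneq => [->|qu]; first by rewrite addrK.
have : ln q - ln u != 0.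
  by rewrite subr_eq0; apply: contra qu => /eqP /ln_inj ->; rewrite ?posrE.
move=> /expR_gt1Dx; rewrite E ltr_pdivlMr// => h.
rewrite -subr_gt0; rewrite -subr_gt0 in h.
by rewrite (_ : _ - _ = q - (1 + (ln q - ln u)) * u)//; ring.
Qed.

(** From ln t < t: if h >= 1 the product is at most h^2, and if h < 1 it is at most h (1/h) = 1. *)
Lemma mul_norm_ln_le h M : 0 <= h <= M -> h * `|ln h| <= 1 + M ^+ 2.
Proof.
move=> /andP[]; rewrite le_eqVlt => /predU1P[<- _|h0 hM].
  by rewrite mul0r addr_ge0// sqr_ge0.
have [h1|h1] := leP 1 h.
  rewrite ger0_norm ?ln_ge0//; apply: (@le_trans _ _ (M ^+ 2)); last first.
    by rewrite lerDr.
  rewrite expr2; apply: ler_pM => //; rewrite ?ln_ge0 ?(ltW h0)//.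
  by rewrite ltW// (lt_le_trans (ln_sublinear h0)).
rewrite ler0_norm ?ln_le0 ?(ltW h1)// -lnV ?posrE//.
apply: (@le_trans _ _ 1); last by rewrite lerDl sqr_ge0.
rewrite -(divff (lt0r_neq0 h0)) ler_pM2l// ltW//.
by rewrite ln_sublinear// invr_gt0.
Qed.

(** Let z be the mixture. If z >= 1, then z is at most the larger of [u] and [v], and t ln t
    increases beyond 1. If z < 1, then z >= a u gives -ln z <= -ln a - ln u for positive [u], and
    likewise for [v]. *)
Lemma mixture_norm_ln_le a c u v : 0 < a -> 0 < c -> a + c = 1 ->
  0 <= u -> 0 <= v ->
  (a * u + c * v) * `|ln (a * u + c * v)| <=
  u * `|ln u| + v * `|ln v| + (`|ln a| * u + `|ln c| * v).
Proof.
move=> a0 c0 ac u0 v0; have a1 : a <= 1 by lra.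
have c1 : c <= 1 by lra.
have rhs : 0 <= u * `|ln u| /\ 0 <= v * `|ln v| /\ 0 <= `|ln a| * u /\
  0 <= `|ln c| * v by rewrite !mulr_ge0.
have : 0 <= a * u + c * v by rewrite addr_ge0// mulr_ge0// ltW.
set z := a * u + c * v; rewrite le_eqVlt => /predU1P[<-|z0].
  by rewrite mul0r; lra.
have [z1|z1] := leP 1 z.
  have zln w : z <= w -> z * `|ln z| <= w * `|ln w|.
    move=> zw; have w0 : 0 < w by exact: lt_le_trans zw.
    have w1 : 1 <= w by exact: le_trans zw.
    rewrite !ger0_norm ?ln_ge0//; apply: ler_pM => //; rewrite ?ln_ge0 ?(ltW z0)//.
    by rewrite ler_ln ?posrE.
  have [uv|vu] := leP u v.
    have /zln : z <= v by rewrite /z; nra.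
    by lra.
  have /zln : z <= u by rewrite /z; nra.
  by lra.
rewrite ler0_norm ?ln_le0 ?(ltW z1)//.
have part k w : 0 < k -> k <= 1 -> 0 <= w -> k * w <= z ->
    k * w * - ln z <= w * `|ln w| + `|ln k| * w.
  move=> k0 k1; rewrite le_eqVlt => /predU1P[<- _|w0 kwz].
    by rewrite mulr0 !mul0r mulr0 addr0.
  have : ln k + ln w <= ln z.
    by rewrite -lnM ?posrE// ler_ln ?posrE// mulr_gt0.
  have := ler_norm (- ln k); have := ler_norm (- ln w).
  rewrite !normrN => hw hk hz.
  have lz : 0 <= - ln z by rewrite oppr_ge0 ln_le0// ltW.
  apply: (@le_trans _ _ (w * - ln z)).
    by rewrite ler_wpM2r// ler_piMl// ltW.
  by rewrite [X in _ + X]mulrC -mulrDr ler_wpM2l ?(ltW w0)//; lra.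
have := @part a u a0 a1 u0; have := @part c v c0 c1 v0.
have cv : 0 <= c * v by rewrite mulr_ge0// ltW.
have au : 0 <= a * u by rewrite mulr_ge0// ltW.
rewrite /z lerDr lerDl au cv => /(_ isT) h1 /(_ isT) h2.
by rewrite mulrDl; lra.
Qed.

End entropy_inequalities.

(** * Densities of finite entropy *)

Section entropy.
Context {R : realType} {d : measure_display} {X : measurableType d}.
Context (mu : {measure set X -> \bar R}).
Implicit Types (f g h q u : X -> R) (M : R).

Definition finite_entropy f : Prop :=
  \int[mu]_x (f x * `|ln (f x)|)%:E < +oo.

Lemma measurable_elog q : measurable_fun setT q ->
  measurable_fun setT (fun x => elog (q x)).
Proof.
move=> mq; rewrite /elog; apply: measurable_fun_ifT => //.
- exact: measurable_fun_ltr.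
- by apply/measurable_EFinP; exact: measurableT_comp.
Qed.

Lemma measurable_mul_norm_ln f : measurable_fun setT f ->
  measurable_fun setT (fun x => (f x * `|ln (f x)|)%:E).
Proof.
move=> mf; apply/measurable_EFinP; apply: measurable_funM => //.
by do 2 apply: measurableT_comp => //.
Qed.

(** Split ln (f h) = ln f + ln h: the first part costs M f |ln f|, the second (1 + M^2) f. *)
Lemma finite_entropy_mul_bounded f h M : is_density mu f ->
  measurable_fun setT h -> (forall x, (0 <= h x <= M)%R) ->
  finite_entropy f -> finite_entropy (fun x => f x * h x)%R.
Proof.
move=> [mf [f0 f1]] mh hM; rewrite /finite_entropy => fe.
have hx0 x : (0 <= h x)%R by case/andP: (hM x).
have hxM x : (h x <= M)%R by case/andP: (hM x).
have mfE : measurable_fun setT (fun x => (f x)%:E) by exact/measurable_EFinP.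
have mln := measurable_mul_norm_ln mf.
have fE0 x : 0 <= (f x)%:E by rewrite lee_fin.
have ln0 x : 0 <= (f x * `|ln (f x)|)%:E by rewrite lee_fin mulr_ge0.
(* The absolute value keeps the coefficient nonnegative: [0 <= M] is only available once a point of
   [X] is given. *)
apply: (@le_lt_trans _ _ (\int[mu]_x
    (`|M|%:E * (f x * `|ln (f x)|)%:E + (1 + M ^+ 2)%:E * (f x)%:E))).
  apply: ge0_le_integral => //.
  - by move=> x _; rewrite lee_fin !mulr_ge0.
  - by apply: measurable_mul_norm_ln; exact: measurable_funM.
  - by apply: emeasurable_funD; exact: measurable_funeM.
  - move=> x _; rewrite -!EFinM -EFinD lee_fin.
    have := f0 x; rewrite le_eqVlt => /predU1P[<-|fx0].
      by rewrite !(mul0r, mulr0) addr0.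
    have := hx0 x; rewrite le_eqVlt => /predU1P[hx|hx].
      by rewrite -hx mulr0 mul0r addr_ge0 ?mulr_ge0 ?addr_ge0 ?sqr_ge0.
    have H := mul_norm_ln_le (hM x).
    have M0 : (0 <= M)%R by rewrite (le_trans (hx0 x)).
    rewrite lnM ?posrE// (ger0_norm M0).
    apply: (@le_trans _ _ (f x * h x * (`|ln (f x)| + `|ln (h x)|))%R).
      by rewrite ler_wpM2l ?mulr_ge0// ler_normD.
    rewrite mulrDr lerD//.
      by rewrite mulrAC mulrC ler_wpM2r// mulr_ge0.
    by rewrite -mulrA mulrC ler_wpM2r.
rewrite ge0_integralD//; last 4 first.
- by move=> x _; rewrite mule_ge0.
- exact: measurable_funeM.
- by move=> x _; rewrite mule_ge0// lee_fin addr_ge0// sqr_ge0.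
- exact: measurable_funeM.
rewrite !ge0_integralZl// ?lee_fin ?addr_ge0 ?sqr_ge0// f1 mule1.
rewrite lte_add_pinfty ?ltry// lte_mul_pinfty//.
Qed.

Section mixture.
Context (f g : X -> R) (a : R).
Context (a0 : (0 < a)%R) (a1 : (a < 1)%R).
Context (fd : is_density mu f) (gd : is_density mu g).
Context (fe : finite_entropy f) (ge : finite_entropy g).

Let u x := (a * f x + (1 - a) * g x)%R.
Let c0 : (0 < 1 - a)%R. Proof. by rewrite subr_gt0. Qed.
Let mf : measurable_fun setT f. Proof. by case: fd. Qed.
Let mg : measurable_fun setT g. Proof. by case: gd. Qed.
Let f0 x : (0 <= f x)%R. Proof. by case: fd => _ []. Qed.
Let g0 x : (0 <= g x)%R. Proof. by case: gd => _ []. Qed.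
Let mfE : measurable_fun setT (fun x => (f x)%:E).
Proof. exact/measurable_EFinP. Qed.
Let mgE : measurable_fun setT (fun x => (g x)%:E).
Proof. exact/measurable_EFinP. Qed.
Let fE0 x : 0 <= (f x)%:E. Proof. by rewrite lee_fin. Qed.
Let gE0 x : 0 <= (g x)%:E. Proof. by rewrite lee_fin. Qed.

Lemma is_density_mixture : is_density mu u.
Proof.
split; first by apply: measurable_funD; exact: measurable_funM.
split; first by move=> x; rewrite addr_ge0// mulr_ge0// ltW.
under eq_integral do rewrite EFinD !EFinM.
rewrite ge0_integralD//; last 4 first.
- by move=> x _; rewrite mule_ge0 ?lee_fin ?(ltW a0).
- exact: measurable_funeM.
- by move=> x _; rewrite mule_ge0 ?lee_fin ?(ltW c0).
- exact: measurable_funeM.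
rewrite !ge0_integralZl// ?lee_fin ?(ltW a0) ?(ltW c0)//.
case: fd => _ [_ ->]; case: gd => _ [_ ->].
by rewrite !mule1 -EFinD addrC subrK.
Qed.

Lemma finite_entropy_mixture : finite_entropy u.
Proof.
pose k x := ((`|ln a| * f x + `|ln (1 - a)| * g x)%R)%:E.
have mk : measurable_fun setT k.
  by apply/measurable_EFinP; apply: measurable_funD; exact: measurable_funM.
have k0 x : 0 <= k x by rewrite lee_fin addr_ge0// mulr_ge0.
have mlf := measurable_mul_norm_ln mf; have mlg := measurable_mul_norm_ln mg.
have lf0 x : 0 <= (f x * `|ln (f x)|)%:E by rewrite lee_fin mulr_ge0.
have lg0 x : 0 <= (g x * `|ln (g x)|)%:E by rewrite lee_fin mulr_ge0.
have [mesu [u0 _]] := is_density_mixture.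
apply: (@le_lt_trans _ _ (\int[mu]_x ((f x * `|ln (f x)|)%:E +
    (g x * `|ln (g x)|)%:E + k x))).
  apply: ge0_le_integral => //.
  - by move=> x _; rewrite lee_fin mulr_ge0.
  - exact: measurable_mul_norm_ln.
  - by apply: emeasurable_funD => //; exact: emeasurable_funD.
  - move=> x _; rewrite -!EFinD lee_fin.
    by apply: mixture_norm_ln_le => //; rewrite addrC subrK.
rewrite ge0_integralD//; [|by move=> x _; rewrite adde_ge0
  |exact: emeasurable_funD].
rewrite lte_add_pinfty//; first by rewrite ge0_integralD// lte_add_pinfty.
under eq_integral do rewrite /k EFinD !EFinM.
rewrite ge0_integralD//; last 4 first.
- by move=> x _; rewrite mule_ge0 ?lee_fin.
- exact: measurable_funeM.
- by move=> x _; rewrite mule_ge0 ?lee_fin.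
- exact: measurable_funeM.
rewrite !ge0_integralZl//.
case: fd => _ [_ ->]; case: gd => _ [_ ->].
by rewrite !mule1 -EFinD ltry.
Qed.

End mixture.

End entropy.

(** * Gibbs' inequality and the maximizer *)

Section gibbs.
Context {R : realType} {d : measure_display} {X : measurableType d}.
Context (mu : {measure set X -> \bar R}).
Implicit Types (f g h q u : X -> R).

(** Extends [mul_ln_le] to the boundary: for [u = 0] the left side is 0 by convention, and for
    [u > 0 = q] it is -oo. *)
Lemma elog_le (u q : R) : (0 <= u)%R -> (0 <= q)%R ->
  u%:E * elog q <= (u * ln u + q - u)%:E.
Proof.
rewrite le_eqVlt => /predU1P[<- q0|u0]; first by rewrite mul0e mul0r add0r subr0.
rewrite le_eqVlt /elog => /predU1P[<-|q0].
  by rewrite ltxx gt0_muleNy ?lte_fin// leNye.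
by rewrite q0 -EFinM lee_fin; exact: mul_ln_le.
Qed.

Lemma elog_eq (u q : R) : (0 <= u)%R -> (0 <= q)%R ->
  u%:E * elog q = (u * ln u + q - u)%:E -> q = u.
Proof.
rewrite le_eqVlt => /predU1P[<- q0|u0].
  by rewrite mul0e mul0r add0r subr0 => -[].
rewrite le_eqVlt /elog => /predU1P[<-|q0].
  by rewrite ltxx gt0_muleNy ?lte_fin.
rewrite q0 -EFinM => -[] /eqP.
by rewrite (mul_ln_le u0 q0).2 => /eqP.
Qed.

Lemma elogxx (u : R) : (0 <= u)%R -> u%:E * elog u = (u * ln u)%:E.
Proof.
rewrite le_eqVlt => /predU1P[<-|u0]; first by rewrite mul0e mul0r.
by rewrite /elog u0.
Qed.

Lemma measurable_mul_elog f q : measurable_fun setT f ->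
  measurable_fun setT q -> measurable_fun setT (fun x => (f x)%:E * elog (q x)).
Proof.
move=> mf mq; apply: emeasurable_funM; first exact/measurable_EFinP.
exact: measurable_elog.
Qed.

Lemma integrable_density f : is_density mu f ->
  mu.-integrable setT (fun x => (f x)%:E).
Proof.
move=> [mf [f0 f1]]; apply/integrableP; split; first exact/measurable_EFinP.
rewrite (eq_integral (fun x => (f x)%:E)) ?f1 ?ltry// => x _.
by rewrite gee0_abs// lee_fin.
Qed.

(** By [elog_le] the positive part is at most |f ln f| + q, hence integrable; an infinite negative
    part would make the integral -oo. *)
Lemma integrable_elog f q : is_density mu f -> is_density mu q ->
  finite_entropy mu f -> -oo < \int[mu]_x ((f x)%:E * elog (q x)) ->
  mu.-integrable setT (fun x => (f x)%:E * elog (q x)).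
Proof.
move=> [mf [f0 f1]] [mq [q0 q1]] fe Foo.
set F := (fun x => (f x)%:E * elog (q x)).
have mF : measurable_fun setT F by exact: measurable_mul_elog.
have mFp := measurable_funepos mF; have mFn := measurable_funeneg mF.
have mqE : measurable_fun setT (fun x => (q x)%:E) by exact/measurable_EFinP.
have mln := measurable_mul_norm_ln mf.
have posoo : \int[mu]_x F^\+ x < +oo.
  apply: (@le_lt_trans _ _ (\int[mu]_x ((f x * `|ln (f x)|)%:E + (q x)%:E))).
    apply: ge0_le_integral => //; first exact: emeasurable_funD.
    move=> x _; rewrite funeposE ge_max; apply/andP; split; last first.
      by rewrite -EFinD lee_fin addr_ge0// mulr_ge0.
    apply: (le_trans (elog_le (f0 x) (q0 x))); rewrite -EFinD lee_fin.
    by rewrite lerBlDr ler_wpDr// lerD2r ler_wpM2l// ler_norm.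
  rewrite ge0_integralD//.
  - by rewrite lte_add_pinfty// q1 ltry.
  - by move=> x _; rewrite lee_fin mulr_ge0.
  - by move=> x _; rewrite lee_fin.
have negoo : \int[mu]_x F^\- x < +oo.
  rewrite ltNge leye_eq; apply/negP => /eqP negy.
  by move: Foo; rewrite integralE negy addeNy.
apply/integrableP; split => //.
rewrite (eq_integral (fun x => F^\+ x + F^\- x)).
  by rewrite ge0_integralD// lte_add_pinfty.
by move=> x _; rewrite -[RHS]/((F^\+ \+ F^\-) x) -fune_abse.
Qed.

(** Each component of a mixture [u] is bounded by a multiple of [u], so both terms of the objective
    are finite at [u]. *)
Lemma integrable_elog_dominated f u (k : R) : measurable_fun setT f ->
  is_density mu u -> (forall x, (0 <= f x <= k * u x)%R) ->
  finite_entropy mu u -> mu.-integrable setT (fun x => (f x)%:E * elog (u x)).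
Proof.
move=> mf [mesu [u0 u1]] fku ue; have mln := measurable_mul_norm_ln mesu.
have lnu0 x : 0 <= (u x * `|ln (u x)|)%:E by rewrite lee_fin mulr_ge0.
apply/integrableP; split; first exact: measurable_mul_elog.
apply: (@le_lt_trans _ _ (\int[mu]_x (`|k|%:E * (u x * `|ln (u x)|)%:E))).
  apply: ge0_le_integral => //.
  - by apply: measurableT_comp => //; exact: measurable_mul_elog.
  - exact: measurable_funeM.
  - move=> x _; have /andP[fx0 fxk] := fku x.
    have := u0 x; rewrite le_eqVlt => /predU1P[ux|ux].
      have -> : f x = 0%R by apply/le_anti; rewrite fx0 (le_trans fxk)// -ux mulr0.
      by rewrite mul0e abse0 mule_ge0// lee_fin.
    rewrite /elog ux -!EFinM lee_fin normrM mulrA ler_wpM2r// ger0_norm//.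
    by apply: (le_trans fxk); rewrite ler_wpM2r// ?ler_norm// ltW.
rewrite ge0_integralZl//.
by rewrite lte_mul_pinfty// lee_fin.
Qed.

(** Gibbs' inequality. The pointwise defect [D] in [elog_le] is nonnegative; if its integral is
    null, then [D = 0] almost everywhere and [elog_eq] applies. *)
Lemma integral_elog_le u q : is_density mu u -> is_density mu q ->
  finite_entropy mu u ->
  mu.-integrable setT (fun x => (u x)%:E * elog (q x)) ->
  \int[mu]_x ((u x)%:E * elog (q x)) <= \int[mu]_x ((u x)%:E * elog (u x)) /\
  (\int[mu]_x ((u x)%:E * elog (u x)) <= \int[mu]_x ((u x)%:E * elog (q x)) ->
   {ae mu, forall x, q x = u x}).
Proof.
move=> ud qd ue iq.
have iu := integrable_density ud; have iqd := integrable_density qd.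
have [mesu [u0 u1]] := ud; have [mq [q0 q1]] := qd.
have ilnu : mu.-integrable setT (fun x => (u x * ln (u x))%:E).
  have ulau x : (0 <= u x <= 1 * u x)%R by rewrite u0 mul1r lexx.
  have := integrable_elog_dominated mesu ud ulau ue.
  by apply: eq_integrable => // x _; rewrite elogxx.
pose T x := (u x * ln (u x) + q x - u x)%:E.
have iT : mu.-integrable setT T.
  have := integrableB measurableT (integrableD measurableT ilnu iqd) iu.
  by apply: eq_integrable => // x _.
(* The terms [q] and [-u] of [T] cancel after integration, both densities having mass 1. *)
have TE : \int[mu]_x T x = \int[mu]_x ((u x)%:E * elog (u x)).
  transitivity (\int[mu]_x (((u x * ln (u x))%:E + (q x)%:E) - (u x)%:E)).
    by apply: eq_integral.
  rewrite integralB//; last exact: integrableD.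
  rewrite integralD// q1 u1 addeK//.
  by apply: eq_integral => x _; rewrite elogxx.
pose D x := T x - (u x)%:E * elog (q x).
have iD : mu.-integrable setT D by exact: integrableB.
have D0 x : 0 <= D x.
  by rewrite sube_ge0 ?orbT// elog_le.
have DE : \int[mu]_x D x = \int[mu]_x ((u x)%:E * elog (u x)) -
    \int[mu]_x ((u x)%:E * elog (q x)) by rewrite integralB// TE.
have qfin : \int[mu]_x ((u x)%:E * elog (q x)) \is a fin_num.
  exact: integrable_fin_num.
split; first by rewrite -sube_ge0 ?qfin// -DE integral_ge0.
move=> ule; have D_eq0 : \int[mu]_x D x = 0.
  by apply/eqP; rewrite eq_le integral_ge0// andbT DE sube_le0.
have /ae_eq_integral_abs : \int[mu]_x `|D x| = 0.
  by rewrite -[RHS]D_eq0; apply: eq_integral => x _; rewrite gee0_abs.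
case=> //; first exact: measurable_int iD.
move=> N [mN N0 subN]; exists N; split => // x /= qu; apply: subN => /= h.
apply: qu; apply: elog_eq => //; have := h I.
rewrite /D /T /cst; case: ((u x)%:E * elog (q x)) => [s||]// /eqP.
by rewrite -EFinB eqe subr_eq0 => /eqP ->.
Qed.

End gibbs.

(** * Log-likelihood under a two-component mixture *)

Section mixture_loglik.
Context {R : realType} {d : measure_display} {X : measurableType d}.
Context (mu : {measure set X -> \bar R}) (f g : X -> R) (a : R).
Context (a0 : (0 < a)%R) (a1 : (a < 1)%R).
Context (fd : is_density mu f) (gd : is_density mu g).
Context (fe : finite_entropy mu f) (ge : finite_entropy mu g).

Let L (q : X -> R) : \bar R := a%:E * \int[mu]_x ((f x)%:E * elog (q x)) +
  (1 - a)%:E * \int[mu]_x ((g x)%:E * elog (q x)).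

Let u x := (a * f x + (1 - a) * g x)%R.

Let c0 : (0 < 1 - a)%R. Proof. by rewrite subr_gt0. Qed.

Let f0 x : (0 <= f x)%R. Proof. by case: fd => _ []. Qed.
Let g0 x : (0 <= g x)%R. Proof. by case: gd => _ []. Qed.

Let L_mixture q :
  mu.-integrable setT (fun x => (f x)%:E * elog (q x)) ->
  mu.-integrable setT (fun x => (g x)%:E * elog (q x)) ->
  mu.-integrable setT (fun x => (u x)%:E * elog (q x)) /\
  L q = \int[mu]_x ((u x)%:E * elog (q x)).
Proof.
move=> ifq igq.
have uE x : (u x)%:E * elog (q x) =
    a%:E * ((f x)%:E * elog (q x)) + (1 - a)%:E * ((g x)%:E * elog (q x)).
  by rewrite /u EFinD ge0_muleDl ?lee_fin ?mulr_ge0 ?(ltW a0) ?(ltW c0)// !EFinM !muleA.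
have iaf := integrableZl measurableT a ifq.
have icg := integrableZl measurableT (1 - a)%R igq.
split.
  have := integrableD measurableT iaf icg.
  by apply: eq_integrable => // x _; rewrite uE.
rewrite /L -!integralZl// -integralD//.
by apply: eq_integral => x _; rewrite uE.
Qed.

Lemma mixture_loglik_max q : is_density mu q ->
  L q <= L u /\ (L u <= L q -> {ae mu, forall x, q x = u x}).
Proof.
move=> qd.
have ud : is_density mu u by exact: is_density_mixture.
have ue : finite_entropy mu u by exact: finite_entropy_mixture.
have [mf _] := fd; have [mg _] := gd.
have au x : (a * f x <= u x)%R by rewrite lerDl mulr_ge0// ltW.
have cu x : ((1 - a) * g x <= u x)%R by rewrite lerDr mulr_ge0// ltW.
have ifu : mu.-integrable setT (fun x => (f x)%:E * elog (u x)).
  apply: (@integrable_elog_dominated _ _ _ _ _ _ a^-1) => // x.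
  by rewrite f0/= mulrC ler_pdivlMr// mulrC.
have igu : mu.-integrable setT (fun x => (g x)%:E * elog (u x)).
  apply: (@integrable_elog_dominated _ _ _ _ _ _ (1 - a)^-1) => // x.
  by rewrite g0/= mulrC ler_pdivlMr// mulrC.
have [iuu LuE] := L_mixture ifu igu.
have Lufin : L u \is a fin_num by rewrite LuE integrable_fin_num.
(* If [L q] is -oo, both claims follow from the finiteness of [L u]. Otherwise neither integral is
   -oo, since -oo absorbs every summand, and both integrands are integrable. *)
have [Lq|Lq] := eqVneq (L q) -oo.
  rewrite Lq leNye; split => // h; move: Lufin.
  by move: h; rewrite leeNy_eq => /eqP ->.
have ifq : mu.-integrable setT (fun x => (f x)%:E * elog (q x)).
  apply: integrable_elog => //; rewrite ltNye; apply: contra Lq => /eqP fq.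
  by rewrite /L fq gt0_muleNy ?lte_fin// addNye.
have igq : mu.-integrable setT (fun x => (g x)%:E * elog (q x)).
  apply: integrable_elog => //; rewrite ltNye; apply: contra Lq => /eqP gq.
  by rewrite /L gq gt0_muleNy ?lte_fin// addeNy.
have [iuq LqE] := L_mixture ifq igq.
by rewrite LuE LqE; exact: integral_elog_le.
Qed.

End mixture_loglik.

(** The recursion is the premise on [s < t], for any choice of successive maximizers. Densities
    represent measures up to null sets, so uniqueness holds almost everywhere. *)
Theorem theorem3 (R : realType) (d : measure_display) (X : measurableType d)
  (pi : {measure set X -> \bar R}) (pi_sf : sigma_finite setT pi)
  (dO : measure_display) (Om : measurableType dO) (P : probability Om R)
  (r : X -> R) (r_meas : measurable_fun setT r)
  (eps : X -> Om -> R)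
  (eps_meas : measurable_fun setT (fun z : X * Om => eps z.1 z.2))
  (alpha : R) (alpha_pos : (0 < alpha)%R) (alpha_lt1 : (alpha < 1)%R)
  (p0 pref : X -> R)
  (p0_dens : is_density pi p0) (pref_dens : is_density pi pref)
  (p0_ent : \int[pi]_x (p0 x * `|ln (p0 x)|)%:E < +oo)
  (pref_ent : \int[pi]_x (pref x * `|ln (pref x)|)%:E < +oo)
  (K : option nat) (K_ge2 : forall k, K = Some k -> (2 <= k)%N)
  (Kinf_int : K = None -> forall p, is_density pi p ->
     \int[pi]_y ((p y)%:E * \int[P]_w (expR `|r y + eps y w|)%:E) < +oo)
  (Kinf_Q : K = None ->
     0 < Qstar pi P r eps < +oo /\ forall x, Qf P r eps x <= Qstar pi P r eps)
  (p : nat -> X -> R) (p_init : p 0%N = p0) :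
  forall t : nat,
    (forall s, (s < t)%N -> is_maximizer pi P r eps K alpha pref (p s) (p s.+1)) ->
    (exists q, is_maximizer pi P r eps K alpha pref (p t) q) /\
    (forall q, is_maximizer pi P r eps K alpha pref (p t) q ->
       {ae pi, forall x, (q x)%:E =
          (alpha * pref x)%:E + ((1 - alpha) * p t x)%:E * H pi P r eps K (p t) x}).
Proof.
(* One step of the recursion from any density of finite entropy; finite entropy of [u] is recorded
   so that the step can be iterated. *)
have step pt : is_density pi pt -> finite_entropy pi pt ->
    exists u : X -> R, [/\ is_density pi u, finite_entropy pi u,
      forall x, (u x)%:E =
        (alpha * pref x)%:E + ((1 - alpha) * pt x)%:E * H pi P r eps K pt x,
      is_maximizer pi P r eps K alpha pref pt u &
      forall q, is_maximizer pi P r eps K alpha pref pt q ->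
        {ae pi, forall x, q x = u x}].
  move=> ptd pte.
  have Kint : K = None ->
      \int[pi]_y ((pt y)%:E * \int[P]_w (expR `|r y + eps y w|)%:E) < +oo.
    by move=> Kinf; exact: Kinf_int.
  have KQ : K = None -> exists2 c, c < +oo & forall x, Qf P r eps x <= c.
    by move=> /Kinf_Q[/andP[_ Qoo] Qle]; exists (Qstar pi P r eps).
  have [h [M [mh hM HE ph1]]] := H_bounded r_meas eps_meas ptd K_ge2 Kint KQ.
  have [mpt [pt0 _]] := ptd.
  pose g x := (pt x * h x)%R.
  have gd : is_density pi g.
    split; first exact: measurable_funM.
    by split => // x; rewrite mulr_ge0//; case/andP: (hM x).
  have ge : finite_entropy pi g by exact: finite_entropy_mul_bounded hM pte.
  have LE q : Lobj pi P r eps K alpha pref pt q =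
      alpha%:E * \int[pi]_x ((pref x)%:E * elog (q x)) +
      (1 - alpha)%:E * \int[pi]_x ((g x)%:E * elog (q x)).
    rewrite /Lobj; congr (_ + _ * _); apply: eq_integral => x _.
    by rewrite HE -EFinM.
  have opt q := @mixture_loglik_max _ _ _ pi pref g alpha alpha_pos alpha_lt1
    pref_dens gd pref_ent ge q.
  pose u x := (alpha * pref x + (1 - alpha) * g x)%R.
  have ud : is_density pi u by exact: is_density_mixture.
  exists u; split => //.
  - exact: finite_entropy_mixture.
  - by move=> x; rewrite HE -EFinM -EFinD -mulrA.
  - by split => // q /opt[]; rewrite !LE.
  - move=> q [qd qmax]; apply: (opt q qd).2.
    by rewrite -!LE; exact: qmax.
move=> t pmax.
have [ptd pte] : is_density pi (p t) /\ finite_entropy pi (p t).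
  elim: t pmax => [_|t IH pmax]; first by rewrite p_init.
  have [s st|ptd pte] := IH; first by apply: pmax; exact: ltnW.
  have [u [ud ue _ _ uniq]] := step _ ptd pte.
  have pS := pmax t (ltnSn t); have [pSd _] := pS.
  split => //; rewrite /finite_entropy.
  (* The chosen maximizer is known only up to a null set, which is enough to inherit the entropy
     bound of [u]. *)
  rewrite (ae_eq_integral (fun x => (u x * `|ln (u x)|)%:E))//.
  - by apply: measurable_mul_norm_ln; case: pSd.
  - by apply: measurable_mul_norm_ln; case: ud.
  - by apply: filterS (uniq _ pS) => x /= -> _.
have [u [_ _ uE umax uniq]] := step _ ptd pte.
split; first by exists u.
by move=> q /uniq; apply: filterS => x ->.
Qed.
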